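(* The Wick product is a continuous function $\widetilde{\mathcal S}_{-1}\times\widetilde{\mathcal S}_{-1}\to\widetilde{\mathcal S}_{-1}$ in the strong topology. Hence $(\widetilde{\mathcal S}_{-1},+,\otimes)$ is a topological $\mathbb C$-algebra.
   Context: $\mathbb N=\{1,2,\dots\}$. $\widetilde\ell$ is the free (non-commutative) monoid generated by symbols $z_1,z_2,\dots$, with identity the empty word. For $\alpha=z_{i_1}\cdots z_{i_m}\in\widetilde\ell$ put $(2\mathbb N)^\alpha=\prod_{k=1}^m(2i_k)$ (empty product $=1$) and $(2\mathbb N)^{\alpha s}=((2\mathbb N)^\alpha)^s$. For $p\in\mathbb Z$, $\Gamma(\mathcal H_p)$ denotes the Hilbert space of formal sums $f=\sum_{\alpha\in\widetilde\ell}f_\alpha e_\alpha$, $f_\alpha\in\mathbb C$, with squared norm $\sum_\alpha|f_\alpha|^2(2\mathbb N)^{\alpha p}<\infty$. $\widetilde{\mathcal S}_1=\bigcap_{p\in\mathbb N}\Gamma(\mathcal H_p)$ is topologized as a countably Hilbert (Fréchet) space, and $\widetilde{\mathcal S}_{-1}=\bigcup_{p\in\mathbb N}\Gamma(\mathcal H_{-p})$ is topologized as its strong dual (the duality being the coefficient pairing $(f,g)\mapsto\sum_\alpha f_\alpha g_\alpha$); this is the strong topology. The Wick product is $f\otimes g=\sum_{\gamma\in\widetilde\ell}\big(\sum_{\alpha\beta=\gamma}f_\alpha g_\beta\big)e_\gamma$. *)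

(* Defs.v *)
From HB Require Import structures.
From mathcomp Require Import all_boot all_order all_algebra.
From mathcomp Require Import complex lra.
From mathcomp Require Import all_classical all_reals all_analysis.
From mathcomp.analysis.showcase Require summability.

Set Implicit Arguments.
Unset Strict Implicit.
Unset Printing Implicit Defensive.

Import Order.TTheory GRing.Theory Num.Theory.
Import ComplexField.Normc numFieldNormedType.Exports.

Local Open Scope classical_set_scope.
Local Open Scope ring_scope.
Local Open Scope complex_scope.

(* The free monoid on z_1, z_2, ..., with [cat] as product and [::] as
   identity; the letter z_k is encoded by the natural number k - 1. *)
Definition word := seq nat.

HB.instance Definition _ := Choice.copy word (seq nat).

Definition weight (a : word) : nat := (\prod_(i <- a) (2 * i.+1))%N.

Lemma weight_gt0 (a : word) : (0 < weight a)%N.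
Proof.
by rewrite /weight; elim/big_ind: _ => // x y; rewrite muln_gt0 => -> ->.
Qed.

Section Gamma.
Variable R : realType.

(* The ^o makes C = R[i] a normed module (hence a uniform space) over itself. *)
Definition coefs := word -> R[i]^o.

HB.instance Definition _ := GRing.Lmodule.copy coefs (word -> R[i]^o).

Implicit Types (f g : coefs) (p q : int).

Definition sqnorm p f : \bar R :=
  \esum_(a in [set: word]) (normc (f a) ^+ 2 * (weight a)%:R ^ p)%:E.

Definition Gamma p : set coefs := [set f | (sqnorm p f < +oo)%E].

Definition hnorm p f : R := Num.sqrt (fine (sqnorm p f)).

Let term p f (a : word) : R := normc (f a) ^+ 2 * (weight a)%:R ^ p.

Let term_ge0 p f a : 0 <= term p f a.
Proof. by rewrite mulr_ge0 ?sqr_ge0// exprz_ge0. Qed.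

Lemma Gamma0 p : Gamma p 0.
Proof.
rewrite /Gamma /= /sqnorm esum1 ?ltry// => a _.
by rewrite [X in normc X]/= normc0 expr0n mul0r.
Qed.

Let normc_ge0 (z : R[i]) : 0 <= normc z.
Proof. by case: z => x y; exact: sqrtr_ge0. Qed.

Let normcD (x y : R[i]) : normc (x + y) <= normc x + normc y.
Proof. exact: (@le_normcD R x y). Qed.

Lemma GammaD p f g : Gamma p f -> Gamma p g -> Gamma p (f + g).
Proof.
rewrite /Gamma /= => fp gp.
have h (F : coefs) a : (0 <= (term p F a)%:E)%E by rewrite lee_fin.
apply: (@le_lt_trans _ _ (sqnorm p f + sqnorm p g + (sqnorm p f + sqnorm p g))%E).
  rewrite /sqnorm -!esumD; try by move=> *; rewrite ?adde_ge0// h.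
  apply: le_esum => a _; rewrite -!EFinD lee_fin -!mulrDl.
  rewrite ler_wpM2r ?exprz_ge0//.
  apply: (@le_trans _ _ ((normc (f a) + normc (g a)) ^+ 2)).
    by rewrite ler_sqr ?nnegrE ?addr_ge0 ?normc_ge0//; exact: normcD.
  have := sqr_ge0 (normc (f a) - normc (g a)); rewrite sqrrB sqrrD.
  by move: (normc _) (normc _) => x y; lra.
by rewrite !lte_add_pinfty.
Qed.

Lemma GammaZ p (c : R[i]) f : Gamma p f -> Gamma p (c *: f).
Proof.
rewrite /Gamma /= => fp.
apply: (@le_lt_trans _ _ ((normc c ^+ 2)%:E * sqnorm p f)%E); last first.
  have : (0 <= sqnorm p f)%E by apply: esum_ge0 => a _; exact: term_ge0.
  case: (sqnorm p f) fp => [r _ _| |_]; [|by rewrite ltxx|by rewrite leeNy_eq].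
  by rewrite -EFinM ltry.
apply: ge_ereal_sup => _ [A [finA _] <-].
under eq_fsbigr do rewrite [X in normc X]/= normcM exprMn -mulrA EFinM.
rewrite -ge0_mule_fsumr; last by move=> a; exact: term_ge0.
rewrite lee_wpmul2l ?lee_fin ?sqr_ge0//.
by apply: ereal_sup_ubound; exists A.
Qed.

Lemma Gamma_le p q f : p <= q -> Gamma q f -> Gamma p f.
Proof.
move=> pq; apply: le_lt_trans; apply: le_esum => a _; rewrite lee_fin.
rewrite ler_wpM2l ?sqr_ge0// ler_weXz2l//.
by rewrite ler1n weight_gt0.
Qed.

Definition S1_set : set coefs :=
  \bigcap_(p in [set p : nat | (0 < p)%N]) Gamma p%:Z.

Definition Sm1_set : set coefs :=
  \bigcup_(p in [set p : nat | (0 < p)%N]) Gamma (- p%:Z).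

Definition in_S1 : {pred coefs} := mem S1_set.
Definition in_Sm1 : {pred coefs} := mem Sm1_set.

Lemma in_S1_submod : submod_closed in_S1.
Proof.
split=> [|c f g]; first by apply/mem_set => p _; exact: Gamma0.
move=> /set_mem fS /set_mem gS; apply/mem_set => p p0.
by apply: GammaD; [apply: GammaZ; exact: fS|exact: gS].
Qed.

Lemma in_Sm1_submod : submod_closed in_Sm1.
Proof.
split=> [|c f g]; first by apply/mem_set; exists 1%N => //; exact: Gamma0.
move=> /set_mem[p p0 fp] /set_mem[q q0 gq]; apply/mem_set.
exists (maxn p q); first by rewrite /= leq_max p0.
apply: GammaD; [apply: GammaZ; move: fp|move: gq]; apply: Gamma_le;
  by rewrite lerN2 lez_nat ?leq_maxl ?leq_maxr.
Qed.

HB.instance Definition _ := GRing.isSubmodClosed.Build R[i] coefs in_S1 in_S1_submod.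
HB.instance Definition _ := GRing.isSubmodClosed.Build R[i] coefs in_Sm1 in_Sm1_submod.

Record S1 := MkS1 { S1_val : coefs; _ : S1_val \in in_S1 }.
HB.instance Definition _ := [isSub for S1_val].
HB.instance Definition _ := [Choice of S1 by <:].
HB.instance Definition _ := [SubChoice_isSubLmodule of S1 by <:].

Record Sm1 := MkSm1 { Sm1_val : coefs; _ : Sm1_val \in in_Sm1 }.
HB.instance Definition _ := [isSub for Sm1_val].
HB.instance Definition _ := [Choice of Sm1 by <:].
HB.instance Definition _ := [SubChoice_isSubLmodule of Sm1 by <:].

(* The topology of the countable family of norms (hnorm p), p = 1, 2, ... *)
Definition S1_open (U : set S1) : Prop :=
  forall f : S1, U f -> exists n : nat, exists2 e : R, 0 < e &
    forall g : S1,
      (forall p : nat, (0 < p <= n)%N -> hnorm p%:Z (S1_val (g - f)) < e) -> U g.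

Lemma S1_openT : S1_open setT.
Proof. by move=> f _; exists 0%N; exists 1. Qed.

Lemma S1_openI : setI_closed S1_open.
Proof.
move=> U V Uo Vo f [/Uo[m [d d0 dU]] /Vo[n [e e0 eV]]].
exists (maxn m n), (Num.min d e); first by rewrite lt_min d0.
move=> g gde; split.
- apply: dU => p /andP[p0 pm].
  by have := gde p; rewrite p0 leq_max pm lt_min => /(_ isT)/andP[].
- apply: eV => p /andP[p0 pn].
  by have := gde p; rewrite p0 leq_max pn orbT lt_min => /(_ isT)/andP[].
Qed.

Lemma S1_open_bigU (I : Type) (F : I -> set S1) :
  (forall i, S1_open (F i)) -> S1_open (\bigcup_i F i).
Proof.
move=> Fo f [i _ /Fo[n [e e0 eF]]]; exists n, e => // g /eF Fg.
by exists i.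
Qed.

HB.instance Definition _ :=
  isOpenTopological.Build S1 S1_openT S1_openI S1_open_bigU.

End Gamma.

(* Von Neumann boundedness. *)
Definition vn_bounded (K : numFieldType) (E : preTopologicalLmodType K)
    (B : set E) : Prop :=
  forall U : set E, nbhs 0 U ->
    exists2 r : K, 0 < r & forall c : K, r <= `|c| -> B `<=` [set c *: u | u in U].

Section strong_dual.
Variable R : realType.

(* [summability.sum] is the unordered sum (limit over finite subsets). *)
Definition pairing (f : S1 R) (g : Sm1 R) : R[i]^o :=
  summability.sum (fun a : word => (S1_val f a * Sm1_val g a : R[i]^o)).

(* The strong dual topology: uniform convergence on the bounded subsets of S1. *)
Definition functional (g : Sm1 R) :
  {family @vn_bounded R[i] (S1 R), S1 R -> R[i]^o} := fun f => pairing f g.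

HB.instance Definition _ :=
  Topological.copy (Sm1 R) (initial_topology functional).

Definition wick (f g : coefs R) : coefs R := fun c =>
  \sum_(ab \in [set ab : word * word | ab.1 ++ ab.2 = c]) f ab.1 * g ab.2.

End strong_dual.

Record is_topological_algebra (K : numFieldType) (A : preTopologicalLmodType K)
    (mul : A -> A -> A) : Prop := {
  talg_mulA : associative mul;
  talg_mulDl : left_distributive mul +%R;
  talg_mulDr : right_distributive mul +%R;
  talg_scalerAl : forall (c : K) x y, c *: mul x y = mul (c *: x) y;
  talg_scalerAr : forall (c : K) x y, c *: mul x y = mul x (c *: y);
  talg_unit : exists one : A, left_id one mul /\ right_id one mul;
  talg_add_continuous : continuous (fun xy : A * A => xy.1 + xy.2);
  talg_scale_continuous : continuous (fun cx : K^o * A => cx.1 *: cx.2);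
  talg_mul_continuous : continuous (fun xy : A * A => mul xy.1 xy.2)
}.

(* Main.v *)
Require Import Defs.
From mathcomp Require Import all_boot all_order all_algebra finmap.
From mathcomp Require Import complex.
From mathcomp Require Import all_classical all_reals all_analysis.
From mathcomp Require Import ring lra.
From mathcomp.analysis.showcase Require summability.
Set Implicit Arguments.
Unset Strict Implicit.
Unset Printing Implicit Defensive.

Import Order.TTheory GRing.Theory Num.Theory.
Import ComplexField.Normc numFieldNormedType.Exports.

Local Open Scope classical_set_scope.
Local Open Scope ring_scope.

Import summability.
#[local] Existing Instance totally_filter.

(** The strong dual topology is a topology of weighted l^1 norms, and for these
    the Wick product is submultiplicative up to a change of weight.

    Call a nonnegative function r on words rapidly decreasing when r(a) w(a)^p
    is bounded for every p, where w is the weight (2N)^a. Since the sum of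
    w(a)^-2 over all words is finite ([esum_weight]), the Hilbert norms can be
    replaced by pointwise bounds: S1 consists of the coefficient families with
    rapidly decreasing modulus ([S1P]), Sm1 of those with at most polynomial
    growth in w ([Sm1P]), and a subset of S1 is bounded exactly when it is
    dominated by one rapidly decreasing r ([bounded_dominated] and
    [dominated_bounded]). The supremum of |<f, g>| over the f dominated by r
    is the sum of r(a) |g(a)|, attained by giving each r(a) the phase that makes
    r(a) g(a) nonnegative ([normc_pairing_le], [dominated_attained]). Hence
    convergence in Sm1 is convergence for all the norms
    |g|_r = \sum_a r(a) |g(a)| with r rapidly decreasing ([cvg_qnormP]).

    Given r, put s(a) = sqrt (sup {r(b) | w(b) >= w(a)}). It is again rapidly
    decreasing, and because w(ab) is at least w(a) and at least w(b), r(ab) is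
    at most both s(a)^2 and s(b)^2, so r(ab) <= s(a) s(b) ([rapid_split]). As
    every word has finitely many factorizations, summing over them gives
    |f * g|_r <= |f|_s |g|_s ([qnorm_wick]). Joint continuity follows as for
    any bounded bilinear map, by expanding f' * g' - f * g around (f, g). *)

(** * Weights of words and the summability of their inverse squares *)

Lemma weight_nil : weight [::] = 1%N.
Proof. by rewrite /weight big_nil. Qed.

Lemma weight_cons i a : weight (i :: a) = (2 * i.+1 * weight a)%N.
Proof. by rewrite /weight big_cons. Qed.

Lemma weight_cat a b : weight (a ++ b) = (weight a * weight b)%N.
Proof. by rewrite /weight big_cat. Qed.

Lemma size_weight a : (size a < weight a)%N.
Proof.
elim: a => [|i a ih]; first by rewrite weight_nil.
rewrite weight_cons /= -mulnA mul2n -addnn.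
by rewrite -addn1 leq_add// (leq_trans _ (leq_pmull _ _))// weight_gt0.
Qed.

Lemma normc_ge0 (R : rcfType) (z : R[i]) : 0 <= normc z.
Proof. by case: z => x y; exact: sqrtr_ge0. Qed.

Section esum_fset.
Variables (R : realType) (T : choiceType).
Implicit Types (F : T -> R) (A : {fset T}).

Lemma esum_le_fset F (e : \bar R) :
  (forall A, ((\sum_(a <- A) F a)%:E <= e)%E) -> (\esum_(a in [set: T]) (F a)%:E <= e)%E.
Proof.
move=> Fe; apply: ge_ereal_sup => _ [A [finA _] <-].
by rewrite fsbig_finite//= sumEFin; exact: Fe.
Qed.

Lemma fset_le_esum F A : (forall a, 0 <= F a) ->
  ((\sum_(a <- A) F a)%:E <= \esum_(a in [set: T]) (F a)%:E)%E.
Proof.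
move=> F0; apply: esum_ge; exists [set` A] => //.
by rewrite fsbig_finite//= set_fsetK sumEFin.
Qed.

Lemma esumZl (c : R) F : 0 <= c -> (forall a, 0 <= F a) ->
  (\esum_(a in [set: T]) (c * F a)%:E = c%:E * \esum_(a in [set: T]) (F a)%:E)%E.
Proof.
have le (d : R) (G : T -> R) : 0 <= d -> (forall a, 0 <= G a) ->
    (\esum_(a in [set: T]) (d * G a)%:E <= d%:E * \esum_(a in [set: T]) (G a)%:E)%E.
  move=> d0 G0; apply: esum_le_fset => A; rewrite -mulr_sumr EFinM lee_wpmul2l//.
  exact: fset_le_esum.
move=> c0 F0; apply/eqP; rewrite eq_le le//=.
have [->|cn0] := eqVneq c 0.
  by rewrite mul0e esum_ge0// => a _; rewrite mul0r.
have cp : 0 < c by rewrite lt_neqAle eq_sym cn0.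
rewrite -lee_pdivlMl//.
under eq_esum => a _ do rewrite -[F a](mulKf cn0).
by apply: le => [|a]; rewrite ?invr_ge0// mulr_ge0.
Qed.

End esum_fset.

Section weight_sum.
Variable R : realType.

(** Telescoping: 1/(i+1)^2 <= 1/i - 1/(i+1) for i > 0. *)
Lemma sum_inv_sqr (k : nat) :
  \sum_(0 <= i < k.+1) ((i.+1)%:R ^- 2 : R) <= 2 - (k.+1)%:R^-1.
Proof.
elim: k => [|k ih]; first by rewrite big_nat1 invr1 expr1n invr1; lra.
rewrite big_nat_recr//=.
apply: le_trans (lerD ih (lexx _)) _.
have h0 : 0 < k.+1%:R :> R by rewrite ltr0n.
set x : R := k.+1%:R in h0 *; have -> : k.+2%:R = x + 1 :> R by rewrite -natr1.
rewrite -subr_ge0.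
have -> : 2 - (x + 1)^-1 - (2 - x^-1 + (x + 1) ^- 2) = x^-1 * (x + 1) ^- 2.
  by field; rewrite !gt_eqF// addr_gt0.
by rewrite mulr_ge0// invr_ge0 ?exprn_ge0// ltW// addr_gt0.
Qed.

(** These finite lists exhaust the monoid as [k] and [m] grow, and the sum of a
    multiplicative function over them obeys the recursion S(m + 1) = 1 + t S(m),
    with t the sum over the letters. *)
Fixpoint words (k m : nat) : seq word :=
  if m is m'.+1 then [::] :: [seq i :: a | i <- iota 0 k, a <- words k m'] else [:: [::]].

Lemma mem_words k m a : (size a <= m)%N -> all (ltn^~ k) a -> a \in words k m.
Proof.
elim: m a => [|m ih] [|i a]//= sa /andP[ik ak].
rewrite inE/=; apply/allpairsP; exists (i, a); split => //=.
- by rewrite mem_iota.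
- exact: ih.
Qed.

Lemma words_uniq k m : uniq (words k m).
Proof.
elim: m => [|m ih]//=; apply/andP; split.
  by apply/allpairsP => -[[i a] []].
by apply: allpairs_uniq; rewrite ?iota_uniq// => -[i a] [j b] _ _ [-> ->].
Qed.

(** With t <= 1/2 the recursion S(m + 1) = 1 + t S(m) preserves S <= 2. *)
Lemma sum_words k m : \sum_(a <- words k m) ((weight a)%:R ^- 2 : R) <= 2.
Proof.
have t2 : \sum_(0 <= i < k) ((2 * i.+1)%:R ^- 2 : R) <= 2^-1.
  under eq_bigr do rewrite natrM exprMn invfM.
  rewrite -mulr_sumr; case: k => [|k]; first by rewrite big_geq// mulr0; lra.
  have := sum_inv_sqr k; have : 0 < (k.+1)%:R^-1 :> R by rewrite invr_gt0 ltr0n.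
  by set s := \sum_(_ <= _ < _) _; set t := _^-1; lra.
elim: m => [|m ih] /=.
  by rewrite big_seq1 weight_nil expr1n invr1; lra.
rewrite big_cons weight_nil expr1n invr1 big_allpairs_dep.
under eq_bigr do under eq_bigr do rewrite weight_cons natrM exprMn invfM.
under eq_bigr do rewrite -mulr_sumr.
rewrite -mulr_suml.
move: t2 ih; rewrite /index_iota subn0.
set s := \sum_(_ <- words _ _) _; set t := \sum_(_ <- _) _ => t2 s2.
have s0 : 0 <= s by apply: sumr_ge0 => a _; rewrite invr_ge0 exprn_ge0.
have t0 : 0 <= t by apply: sumr_ge0 => a _; rewrite invr_ge0 exprn_ge0.
nra.
Qed.

Lemma esum_weight : (\esum_(a in [set: word]) ((weight a)%:R ^- 2 : R)%:E <= 2%:E)%E.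
Proof.
apply: esum_le_fset => A; rewrite lee_fin.
(* Every finite set of words lies in some [words k m]. *)
pose m := \max_(a <- A) size a; pose k := \max_(a <- A) \max_(i <- a) i.+1.
apply: le_trans (sum_words k m).
have sub : {subset (A : seq word) <= words k m}.
  move=> a aA; apply: mem_words; first exact: leq_bigmax_seq.
  apply/allP => i ia; apply: (@leq_trans (\max_(j <- a) j.+1)).
    exact: (@leq_bigmax_seq _ _ _ (fun j => j.+1)).
  exact: (@leq_bigmax_seq _ _ _ (fun b : word => \max_(j <- b) j.+1)).
rewrite [leRHS](bigID (mem (A : seq word)))/=.
apply: ler_wpDr; first by apply: sumr_ge0 => a _; rewrite invr_ge0 exprn_ge0.
rewrite -[leRHS]big_filter.
rewrite (perm_big [seq a <- words k m | a \in A]) //.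
apply: uniq_perm; rewrite ?filter_uniq ?words_uniq// => a.
by rewrite mem_filter; case aA: (a \in _) => //=; rewrite sub.
Qed.

End weight_sum.

(** * The spaces S1 and Sm1 in terms of pointwise bounds *)

Section growth.
Variable R : realType.
Implicit Types (f g : coefs R) (r : word -> R) (p : nat).

Local Notation w a := ((weight a)%:R : R).

Lemma w_gt0 a : 0 < w a.
Proof. by rewrite ltr0n weight_gt0. Qed.

Lemma w_ge1 a : 1 <= w a.
Proof. by rewrite ler1n weight_gt0. Qed.

Lemma wX_gt0 a p : 0 < w a ^+ p.
Proof. by rewrite exprn_gt0// w_gt0. Qed.

Lemma ler_wX a p q : (p <= q)%N -> w a ^+ p <= w a ^+ q.
Proof. by move=> pq; rewrite ler_weXn2l// w_ge1. Qed.

Lemma sqnorm_pt (n : int) f a : ((normc (f a) ^+ 2 * w a ^ n)%:E <= sqnorm n f)%E.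
Proof.
have := @fset_le_esum R word (fun a => normc (f a) ^+ 2 * w a ^ n) [fset a]%fset.
rewrite big_seq_fset1; apply => b.
by rewrite mulr_ge0 ?sqr_ge0// exprz_ge0// ltW// w_gt0.
Qed.

Lemma sqnorm_pt_fin (n : int) f a : Gamma n f ->
  normc (f a) ^+ 2 * w a ^ n <= fine (sqnorm n f).
Proof.
move=> fn; rewrite -lee_fin fineK ?sqnorm_pt// ge0_fin_numE//.
by apply: le_trans (sqnorm_pt n f [::]); rewrite lee_fin mulr_ge0 ?sqr_ge0// exprz_ge0.
Qed.

(** The spare factor w^-2 is what makes a pointwise bound summable; this is how
    the nuclearity of the scale of Hilbert spaces enters. *)
Lemma sqnorm_ub (n : int) f C :
  (forall a, normc (f a) ^+ 2 * w a ^ n <= C * w a ^- 2) ->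
  (sqnorm n f <= (C * 2)%:E)%E.
Proof.
move=> fC; have C0 : 0 <= C.
  have := fC [::]; rewrite weight_nil expr1n invr1 mulr1 exp1rz mulr1; apply: le_trans.
  exact: sqr_ge0.
apply: (@le_trans _ _ (\esum_(a in [set: word]) (C * w a ^- 2)%:E)%E).
  by apply: le_esum => a _; rewrite lee_fin.
rewrite esumZl//.
by rewrite EFinM lee_wpmul2l// esum_weight.
Qed.

(** The exponent 2p would do when p > 0; 2p + 2 is positive at p = 0 as well,
    which matters since the intersection defining S1 starts at exponent 1. *)
Lemma hnorm_pt p f a : Gamma (p.*2.+2)%:Z f ->
  normc (f a) * w a ^+ p <= hnorm (p.*2.+2)%:Z f.
Proof.
move=> fp; have x0 : 0 <= normc (f a) := normc_ge0 _.
apply: (@le_trans _ _ (Num.sqrt ((normc (f a) * w a ^+ p) ^+ 2))).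
  by rewrite sqrtr_sqr ler_norm.
rewrite ler_wsqrtr//; apply: le_trans (sqnorm_pt_fin a fp).
rewrite -exprnP exprMn -exprM ler_wpM2l ?sqr_ge0// ler_wX//.
by rewrite muln2 leqW// leqW.
Qed.

Lemma hnorm_ub (n : int) f C :
  (forall a, normc (f a) ^+ 2 * w a ^ n <= C * w a ^- 2) ->
  hnorm n f <= Num.sqrt (C * 2).
Proof.
move=> /sqnorm_ub fC; rewrite ler_wsqrtr//.
rewrite -[leRHS]/(fine (C * 2)%:E) fine_le// ge0_fin_numE.
  exact: le_lt_trans fC (ltry _).
by apply: esum_ge0 => a _; rewrite lee_fin mulr_ge0 ?sqr_ge0// exprz_ge0.
Qed.

Definition rapid r :=
  (forall a, 0 <= r a) /\ forall p, exists C, forall a, r a * w a ^+ p <= C.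

Lemma rapid_bound r p : rapid r -> exists2 C, 0 <= C & forall a, r a * w a ^+ p <= C.
Proof.
move=> [r0 /(_ p)[C rC]]; exists C => //.
by apply: le_trans (rC [::]); rewrite mulr_ge0 ?r0// ltW ?wX_gt0.
Qed.

Lemma S1P f : (f \in @in_S1 R) <-> rapid (fun a => normc (f a)).
Proof.
split=> [/set_mem fS|[_ fr]].
  split=> [a|p]; first exact: normc_ge0.
  have fp : Gamma (p.*2.+2)%:Z f by apply: fS.
  by exists (hnorm (p.*2.+2)%:Z f) => a; exact: hnorm_pt.
apply/mem_set => p _; have [C fC] := fr p.+2.
apply: (@le_lt_trans _ _ (C ^+ 2 * 2)%:E); last exact: ltry.
apply: sqnorm_ub => a; rewrite -exprnP ler_pdivlMr ?wX_gt0// -mulrA -exprD addn2.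
have := fC a => /=; set x := normc _ => h.
have x0 : 0 <= x := normc_ge0 _.
apply: (@le_trans _ _ ((x * w a ^+ p.+2) ^+ 2)).
  by rewrite exprMn -exprM ler_wpM2l ?sqr_ge0// ler_wX// muln2 -addnn leq_addr.
by rewrite ler_sqr// nnegrE ?(le_trans _ h)// mulr_ge0// ltW// wX_gt0.
Qed.

Definition growth f := exists p C, forall a, normc (f a) <= C * w a ^+ p.

Lemma Sm1P f : (f \in @in_Sm1 R) <-> growth f.
Proof.
split=> [/set_mem[p p0 fp]|[p [C fC]]].
  exists p, (fine (sqnorm (- p%:Z) f) + 1) => a.
  have := sqnorm_pt_fin a fp; rewrite -exprnN.
  set x := normc _; set y := fine _; rewrite ler_pdivrMr ?wX_gt0// => h.
  have x0 : 0 <= x := normc_ge0 _.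
  have W1 : 1 <= w a ^+ p by rewrite exprn_ege1// w_ge1.
  move: W1 h; set W := w a ^+ p => W1 h.
  have y0 : 0 <= y.
    by rewrite -(@pmulr_lge0 _ W) ?(le_trans _ h) ?sqr_ge0// (lt_le_trans _ W1).
  rewrite -ler_sqr ?nnegrE//; last by rewrite mulr_ge0; lra.
  apply: (le_trans h); rewrite exprMn; nra.
apply/mem_set; exists (p.*2.+2) => //.
apply: (@le_lt_trans _ _ (C ^+ 2 * 2)%:E); last exact: ltry.
apply: sqnorm_ub => a; rewrite -exprnN ler_pdivrMr ?wX_gt0//.
rewrite -mulrA -[p.*2.+2]addn2 exprD [_ ^- 2 * _]mulrC mulfK ?gt_eqF ?wX_gt0//.
have := fC a => /=; set x := normc _ => h.
have x0 : 0 <= x := normc_ge0 _.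
rewrite -muln2 exprM -exprMn ler_sqr// nnegrE (le_trans _ h)//.
Qed.

End growth.

(** * Bounded subsets of S1 *)

Section bounded.
Variable R : realType.
Implicit Types (f g : S1 R) (r : word -> R) (p : nat) (B : set (S1 R)).

Local Notation w a := ((weight a)%:R : R).

Lemma normE (z : R[i]) : `|z| = (normc z)%:C%C.
Proof. by []. Qed.

Lemma S1_rapid f : rapid (fun a => normc (S1_val f a)).
Proof. by apply/S1P; case: f. Qed.

Lemma S1_Gamma f p : (0 < p)%N -> Gamma p%:Z (S1_val f).
Proof. by move=> p0; case: f => f /= /set_mem; exact. Qed.

Lemma S1_valB f g a : S1_val (f - g) a = S1_val f a - S1_val g a.
Proof. by []. Qed.

Lemma S1_valZ c f a : S1_val (c *: f) a = c * S1_val f a.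
Proof. by []. Qed.

(** Sup-norm balls, used as neighbourhoods of 0 instead of the Hilbert balls
    because their openness only needs the triangle inequality for moduli.
    Asking for a bound d < 1 uniform in the word makes them open. *)
Definition wball p : set (S1 R) :=
  [set f | exists2 d : R, d < 1 & forall a, normc (S1_val f a) * w a ^+ p <= d].

Lemma nbhs_wball p : nbhs (0 : S1 R) (wball p).
Proof.
rewrite nbhsE; exists (wball p) => //; split; last first.
  by exists 0 => [|a]; rewrite ?ltr01// normc0 mul0r.
move=> f [d d1 fd]; exists p.*2.+2, ((1 - d) / 2); first by lra.
move=> g /(_ p.*2.+2); rewrite ltnS leqnn => /(_ isT) gf.
exists ((1 + d) / 2) => [|a]; first by lra.
have := @hnorm_pt R p (S1_val (g - f)) a (S1_Gamma _ (ltn0Sn _)) => /le_lt_trans/(_ gf).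
have -> : S1_val g a = S1_val f a + S1_val (g - f) a by rewrite S1_valB addrC subrK.
have := le_normcD (S1_val f a) (S1_val (g - f) a).
move/(ler_wpM2r (ltW (wX_gt0 R a p))); rewrite mulrDl.
have := fd a; lra.
Qed.

Definition dominated r : set (S1 R) :=
  [set f | forall a, normc (S1_val f a) <= r a].

(** The dominating function is the pointwise supremum of the moduli over [B];
    absorption of [B] by each [wball p] bounds it by C_p w^-p. *)
Lemma bounded_dominated B : vn_bounded B -> exists2 r, rapid r & B `<=` dominated r.
Proof.
move=> Bb.
have Bp p : exists C, forall f, B f -> forall a, normc (S1_val f a) * w a ^+ p <= C.
  have [c c0 /(_ c) Bc] := Bb _ (nbhs_wball p).
  have cn : c <= `|c| by rewrite real_ler_norm // ger0_real //; exact: ltW.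
  exists (normc c) => f /(Bc cn)[u [d d1 ud] <-] a.
  rewrite S1_valZ normcM -mulrA ler_piMr ?normc_ge0//.
  exact: le_trans (ud a) (ltW d1).
pose X a := [set normc (S1_val f a) | f in B].
have X0 a x : X a x -> 0 <= x by move=> [f _ <-]; exact: normc_ge0.
have ubX a : has_ubound (X a).
  have [C BC] := Bp 0%N; exists C => _ [f Bf <-].
  by have := BC f Bf a; rewrite mulr1.
exists (fun a => sup (X a)) => [|f Bf a]; last first.
  by apply: sup_ubound => //; exists f.
have [B0|/set0P[f Bf]] := eqVneq B set0.
  split=> [a|p]; first by rewrite /X B0 image_set0 sup0.
  by exists 0 => a; rewrite /X B0 image_set0 sup0 mul0r.
have XX a : X a !=set0 by exists (normc (S1_val f a)), f.
split=> [a|p].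
  by apply: le_trans (normc_ge0 (S1_val f a)) _; apply: sup_ubound => //; exists f.
have [C BC] := Bp p; exists C => a.
rewrite -ler_pdivlMr ?wX_gt0//; apply: ge_sup => // _ [g Bg <-].
by rewrite ler_pdivlMr ?wX_gt0// BC.
Qed.

(** A basic neighbourhood of 0 controls the finitely many norms p <= n, and all
    of these are controlled by the bound on r w^(n + 2). *)
Lemma dominated_bounded r : rapid r -> vn_bounded (dominated r).
Proof.
move=> rr U; rewrite nbhsE => -[V [Vo V0] VU].
have [n [e e0 Ve]] := Vo _ V0.
have [C C0 rC] := rapid_bound n.+2 rr.
have r0 : forall a, 0 <= r a by case: rr.
have K0 : 0 < 2 * C / e + 1 by rewrite ltr_wpDl// !mulr_ge0// invr_ge0 ltW.
exists (real_complex R (2 * C / e + 1)); first by rewrite ltcR.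
move=> c; rewrite normE lecR => rc f fr.
have cp : 0 < normc c := lt_le_trans K0 rc.
have cn0 : c != 0 by apply: contraTneq cp => ->; rewrite normc0 ltxx.
exists (c^-1 *: f); last by rewrite scalerA divff// scale1r.
apply: VU; apply: Ve => p /andP[p0 pn]; rewrite subr0.
apply: (@le_lt_trans _ _ (Num.sqrt (((normc c)^-1 * C) ^+ 2 * 2))).
  apply: hnorm_ub => a; rewrite S1_valZ normcM normcV -exprnP.
  rewrite ler_pdivlMr ?wX_gt0// -mulrA -exprD addn2 !exprMn -mulrA.
  rewrite ler_wpM2l ?sqr_ge0//.
  apply: (@le_trans _ _ ((r a * w a ^+ n.+2) ^+ 2)).
    rewrite exprMn; apply: ler_pM; rewrite ?sqr_ge0//.
    - by rewrite ler_sqr ?nnegrE ?normc_ge0// fr.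
    - by rewrite -exprM ler_wX// muln2 -addnn (leq_trans _ (leq_addr _ _)).
  by rewrite ler_sqr// nnegrE// mulr_ge0// ltW// wX_gt0.
have q0 : 0 <= (normc c)^-1 * C by rewrite mulr_ge0// invr_ge0 ltW.
apply: (@le_lt_trans _ _ (Num.sqrt ((2 * ((normc c)^-1 * C)) ^+ 2))).
  by rewrite ler_wsqrtr//; set q := _ * C; nra.
rewrite sqrtr_sqr ger0_norm; last by rewrite mulr_ge0.
rewrite -(ltr_pM2l cp).
have -> : normc c * (2 * ((normc c)^-1 * C)) = 2 * C by field; rewrite gt_eqF.
by rewrite -ltr_pdivrMr// (lt_le_trans _ rc)//; lra.
Qed.

End bounded.

(** * The Wick product and weighted norms *)

Definition cat_fibre (c : word) : set (word * word) := [set ab | ab.1 ++ ab.2 = c].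

(** The factorizations of [c] are its cuts at positions 0, ..., size c. *)
Definition cut (c : word) (k : nat) : word * word := (take k c, drop k c).

Lemma cut_bij c : set_bij `I_(size c).+1 (cat_fibre c) (cut c).
Proof.
split=> [k _|k l|[a b] /= <-]; first exact: cat_take_drop.
- rewrite !inE /= !ltnS => kc lc [/(congr1 size)]; rewrite !size_takel//.
- exists (size a); first by rewrite /= size_cat ltnS leq_addr.
  by rewrite /cut take_size_cat// drop_size_cat.
Qed.

Lemma finite_cat_fibre c : finite_set (cat_fibre c).
Proof.
by have [_ _ /sub_finite_set] := cut_bij c; apply; exact: finite_image.
Qed.

Lemma fsbig_cat_fibre (V : Type) (idx : V) (op : Monoid.com_law idx)
    (F : word * word -> V) c :
  \big[op/idx]_(ab \in cat_fibre c) F ab = \big[op/idx]_(k < (size c).+1) F (cut c k).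
Proof.
rewrite (fsbig_ord op _ (F \o cut c)); apply: reindex_fsbig; exact: cut_bij.
Qed.

Section wick.
Variable R : realType.
Implicit Types (f g h : coefs R) (a b c : word).

Local Notation w a := ((weight a)%:R : R).

Lemma wickE f g c :
  wick f g c = \sum_(k < (size c).+1) f (take k c) * g (drop k c).
Proof. exact: (fsbig_cat_fibre _ (fun ab => f ab.1 * g ab.2)). Qed.

Lemma wick_nil f g : wick f g [::] = f [::] * g [::].
Proof. by rewrite wickE big_ord1. Qed.

(** Left division by a letter. It satisfies the Leibniz-type rule
    [lderiv_wick], which reduces associativity to an induction on the word. *)
Definition lderiv (i : nat) f : coefs R := fun a => f (i :: a).

Lemma wick_cons f g i c :
  wick f g (i :: c) = f [::] * g (i :: c) + wick (lderiv i f) g c.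
Proof. by rewrite !wickE big_ord_recl. Qed.

Lemma wickDl f g h : wick (f + g) h = wick f h + wick g h.
Proof.
apply/funext => c; transitivity (wick f h c + wick g h c) => //.
rewrite !wickE -big_split; apply: eq_bigr => k _; exact: mulrDl.
Qed.

Lemma wickDr f g h : wick f (g + h) = wick f g + wick f h.
Proof.
apply/funext => c; transitivity (wick f g c + wick f h c) => //.
rewrite !wickE -big_split; apply: eq_bigr => k _; exact: mulrDr.
Qed.

Lemma wickZl (z : R[i]) f g : wick (z *: f) g = z *: wick f g.
Proof.
apply/funext => c; transitivity (z * wick f g c) => //.
by rewrite !wickE mulr_sumr; apply: eq_bigr => k _; rewrite mulrA.
Qed.

Lemma wickZr (z : R[i]) f g : wick f (z *: g) = z *: wick f g.
Proof.
apply/funext => c; transitivity (z * wick f g c) => //.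
by rewrite !wickE mulr_sumr; apply: eq_bigr => k _; rewrite mulrCA.
Qed.

Lemma lderiv_wick i f g :
  lderiv i (wick f g) = f [::] *: lderiv i g + wick (lderiv i f) g.
Proof. by apply/funext => c; rewrite /lderiv wick_cons. Qed.

Lemma wickA f g h : wick f (wick g h) = wick (wick f g) h.
Proof.
apply/funext => c; elim: c f g => [|i c ih] f g; first by rewrite !wick_nil mulrA.
rewrite !wick_cons lderiv_wick wickDl wickZl ih mulrDr wick_nil mulrA -addrA.
by [].
Qed.

Definition wick_one : coefs R := fun a => (a == [::])%:R.

Lemma wick1l f : wick wick_one f = f.
Proof.
apply/funext => c; rewrite wickE big_ord_recl take0 drop0 /wick_one eqxx.
rewrite mul1r big1 ?addr0// => k _.
by case: c k => [[]//|i c k] /=; rewrite mul0r.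
Qed.

Lemma wick1r f : wick f wick_one = f.
Proof.
apply/funext => c; rewrite wickE big_ord_recr /= take_size drop_size /wick_one eqxx.
rewrite mulr1 big1 ?add0r// => k _ /=.
have : drop k c != [::] by rewrite -size_eq0 size_drop subn_eq0 -ltnNge.
by move=> /negbTE ->; rewrite mulr0.
Qed.

Lemma normc_sum (I : Type) (s : seq I) (F : I -> R[i]) :
  normc (\sum_(i <- s) F i) <= \sum_(i <- s) normc (F i).
Proof.
elim: s => [|i s ih]; first by rewrite !big_nil normc0.
by rewrite !big_cons (le_trans (le_normcD _ _))// lerD2l.
Qed.

(** Each of the |c| + 1 factorizations of c contributes at most C D w(c)^(p+q),
    and |c| + 1 <= w(c). *)
Lemma growth_wick f g : growth f -> growth g -> growth (wick f g).
Proof.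
move=> [p [C fC]] [q [D gD]].
have C0 : 0 <= C.
  by have := fC [::]; rewrite weight_nil expr1n mulr1; apply: le_trans; exact: normc_ge0.
have D0 : 0 <= D.
  by have := gD [::]; rewrite weight_nil expr1n mulr1; apply: le_trans; exact: normc_ge0.
exists (p + q).+1, (C * D) => c; rewrite wickE.
apply: le_trans (normc_sum _ _) _.
apply: (@le_trans _ _ (\sum_(k < (size c).+1) C * D * w c ^+ (p + q))).
  apply: ler_sum => k _; rewrite normcM -mulrA.
  apply: (@le_trans _ _ ((C * w (take k c) ^+ p) * (D * w (drop k c) ^+ q))).
    by apply: ler_pM => //; exact: normc_ge0.
  rewrite mulrACA -mulrA ler_wpM2l// ler_wpM2l// exprD.
  have -> : w c = w (take k c) * w (drop k c) by rewrite -natrM -weight_cat cat_take_drop.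
  by apply: ler_pM; rewrite ?exprn_ge0// lerXn2r
    ?nnegrE ?mulr_ge0// ?ler_peMr ?ler_peMl// w_ge1.
rewrite sumr_const card_ord -[leLHS]mulr_natl exprS [leRHS]mulrCA.
by rewrite ler_wpM2r ?mulr_ge0 ?exprn_ge0// ler_nat size_weight.
Qed.

Definition wnorm (r : word -> R) f : \bar R :=
  \esum_(a in [set: word]) (r a * normc (f a))%:E.

Lemma wnorm_ge0 (r : word -> R) f : (forall a, 0 <= r a) -> (0 <= wnorm r f)%E.
Proof.
by move=> r0; apply: esum_ge0 => a _; rewrite lee_fin mulr_ge0// normc_ge0.
Qed.

Lemma wnorm_fin (r : word -> R) f : rapid r -> growth f -> wnorm r f \is a fin_num.
Proof.
move=> rr [p [C fC]]; have [D D0 rD] := rapid_bound (p + 2) rr.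
have r0 : forall a, 0 <= r a by case: rr.
have C0 : 0 <= C.
  by have := fC [::]; rewrite weight_nil expr1n mulr1; apply: le_trans; exact: normc_ge0.
rewrite ge0_fin_numE ?wnorm_ge0//.
apply: (@le_lt_trans _ _ (\esum_(a in [set: word]) (C * D * w a ^- 2)%:E)%E).
  apply: le_esum => a _; rewrite lee_fin ler_pdivlMr ?wX_gt0//.
  apply: (@le_trans _ _ (r a * (C * w a ^+ p) * w a ^+ 2)).
    by rewrite ler_wpM2r ?exprn_ge0// ler_wpM2l.
  rewrite (_ : _ * _ = C * (r a * w a ^+ (p + 2))) ?ler_wpM2l// exprD; ring.
rewrite esumZl ?mulr_ge0//.
by apply: le_lt_trans (lee_wpmul2l _ (esum_weight R)) _;
  rewrite ?lee_fin ?mulr_ge0// -EFinM ltry.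
Qed.

Lemma wnormD (r : word -> R) f g : (forall a, 0 <= r a) ->
  (wnorm r (f + g)%R <= wnorm r f + wnorm r g)%E.
Proof.
move=> r0; rewrite -esumD; [|by move=> a _; rewrite lee_fin mulr_ge0// normc_ge0..].
apply: le_esum => a _; rewrite -EFinD lee_fin -mulrDr ler_wpM2l//.
exact: (@le_normcD R).
Qed.

Lemma wnormZ (r : word -> R) (z : R[i]) f : (forall a, 0 <= r a) ->
  (wnorm r (z *: f)%R = (normc z)%:E * wnorm r f)%E.
Proof.
move=> r0; rewrite -esumZl ?normc_ge0// => [|a]; last by rewrite mulr_ge0// normc_ge0.
by apply: eq_esum => a _; rewrite normcM mulrCA.
Qed.

(** Grouping the pairs of words by their product turns the double series for
    [wnorm s f * wnorm s g] into a sum over fibres of concatenation, which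
    dominates [wnorm r (wick f g)] term by term. *)
Lemma wnorm_wick (r s : word -> R) f g :
  (forall a, 0 <= r a) -> (forall a, 0 <= s a) ->
  (forall a b, r (a ++ b) <= s a * s b) -> wnorm s g \is a fin_num ->
  (wnorm r (wick f g) <= wnorm s f * wnorm s g)%E.
Proof.
move=> r0 s0 rs gfin.
pose F ab := s ab.1 * normc (f ab.1) * (s ab.2 * normc (g ab.2)).
have F0 ab : 0 <= F ab by rewrite !mulr_ge0// normc_ge0.
apply: (@le_trans _ _ (\esum_(c in [set: word]) \esum_(ab in cat_fibre c) (F ab)%:E)%E).
  apply: le_esum => c _.
  rewrite esum_fset ?fsbig_cat_fibre;
    [|exact: finite_cat_fibre|by move=> *; rewrite lee_fin].
  rewrite sumEFin lee_fin wickE.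
  apply: (le_trans (ler_wpM2l (r0 _) (normc_sum _ _))); rewrite mulr_sumr.
  apply: ler_sum => k _; rewrite normcM /F /= mulrACA ler_wpM2r ?mulr_ge0 ?normc_ge0//.
  by rewrite -{1}(cat_take_drop k c) rs.
rewrite esum_esum => [|c ab _ _]; last by rewrite lee_fin.
rewrite (reindex_esum [set: word * word] _ (fun ab => (ab.1 ++ ab.2, ab))); last first.
  split=> [ab _|ab ab' _ _ [_ ->]//|[c ab] [/= _ <-]]; first by split.
  by exists ab.
rewrite /=.
rewrite (_ : [set: word * word] = [set: word] `*`` fun=> [set: word]); last first.
  by apply/seteqP; split.
rewrite -(@esum_esum _ _ _ _ _ (fun a b => (F (a, b))%:E)) => [|a b _ _]; last first.
  by rewrite lee_fin.
have nf a : 0 <= s a * normc (f a) by rewrite mulr_ge0// normc_ge0.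
have ng a : 0 <= s a * normc (g a) by rewrite mulr_ge0// normc_ge0.
under eq_esum => a _ do rewrite /F /= esumZl// -/(wnorm s g)
  -[X in (_ * X)%E](fineK gfin) -EFinM mulrC.
by rewrite esumZl// ?fine_ge0 ?wnorm_ge0// fineK// muleC.
Qed.

(** A single weight s on both factors is possible because w is at least 1, so
    that ab is among the words entering the supremum for a and the one for b. *)
Lemma rapid_split (r : word -> R) : rapid r ->
  exists2 s : word -> R, rapid s & forall a b, r (a ++ b) <= s a * s b.
Proof.
move=> rr; have r0 : forall a, 0 <= r a by case: rr.
pose X a := [set r b | b in [set b | (weight a <= weight b)%N]].
have Xr a : X a (r a) by exists a => /=.
have X_bound p : exists2 C, 0 <= C & forall a x, X a x -> x * w a ^+ p <= C.
  have [C C0 rC] := rapid_bound p rr; exists C => // a _ [b /= ab <-].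
  by apply: le_trans (rC b); rewrite ler_wpM2l// lerXn2r ?nnegrE// ler_nat.
have ubX a : has_ubound (X a).
  by have [C _ XC] := X_bound 0%N; exists C => x /XC; rewrite mulr1.
have supX a b : X a (r b) -> r b <= sup (X a) by move=> ?; apply: sup_ubound.
have sup0 a : 0 <= sup (X a) by apply: le_trans (r0 a) (supX _ _ _).
exists (fun a => Num.sqrt (sup (X a))) => [|a b].
  split=> [a|p]; first exact: sqrtr_ge0.
  have [C C0 XC] := X_bound p.*2; exists (Num.sqrt C) => a.
  rewrite -[w a ^+ p]ger0_norm ?exprn_ge0// -sqrtr_sqr -sqrtrM// ler_wsqrtr//.
  rewrite -exprM muln2 -ler_pdivlMr ?wX_gt0//; apply: ge_sup; first by exists (r a).
  by move=> x /XC; rewrite -ler_pdivlMr ?wX_gt0.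
have le1 : r (a ++ b) <= sup (X a).
  by apply: supX; exists (a ++ b) => //=; rewrite weight_cat leq_pmulr// weight_gt0.
have le2 : r (a ++ b) <= sup (X b).
  by apply: supX; exists (a ++ b) => //=; rewrite weight_cat leq_pmull// weight_gt0.
rewrite -sqrtrM// -[leLHS]ger0_norm// -sqrtr_sqr ler_wsqrtr// expr2.
by apply: ler_pM.
Qed.

End wick.

(** * Absolutely convergent unordered sums of complex numbers *)

Section unordered_sum.
Variables (R : realType) (T : choiceType).
Implicit Types (A B : {fset T}) (M : R).

Lemma partial_sumE (V : zmodType) (x : T -> V) A : partial_sum x A = \sum_(a <- A) x a.
Proof. by rewrite /partial_sum big_seq_fsetE. Qed.

Lemma ler_sum_fset (y : T -> R) A B : (forall a, 0 <= y a) -> (A `<=` B)%fset ->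
  \sum_(a <- A) y a <= \sum_(a <- B) y a.
Proof.
move=> y0 AB; rewrite [leRHS](big_fsetID _ (mem A))/=.
rewrite (_ : [fset x | x in B & x \in A]%fset = A).
  by rewrite lerDl sumr_ge0.
apply/fsetP => a; rewrite !inE/=.
by have := fsubsetP AB a; case: (a \in A) => [->|]//; rewrite andbF.
Qed.

Lemma near_totally A : \forall B \near (@totally T), (A `<=` B)%fset.
Proof. by exists A. Qed.

Lemma ge0_cvg_partial_sum (y : T -> R) M : (forall a, 0 <= y a) ->
  (forall A, \sum_(a <- A) y a <= M) -> exists l : R, partial_sum y @ totally --> l.
Proof.
move=> y0 yM; pose X := range (fun A => \sum_(a <- A) y a).
have supX : has_sup X.
  split; first by exists (\sum_(a <- fset0) y a), fset0.
  by exists M => _ [A _ <-].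
exists (sup X); apply/cvgrPdist_le => e e0.
have [_ [A _ <-] Ae] := sup_adherent e0 supX.
near=> B; rewrite partial_sumE ler_distlC.
have XB : \sum_(a <- B) y a <= sup X by apply: ub_le_sup; [case: supX|exists B].
have : \sum_(a <- A) y a <= \sum_(a <- B) y a.
  by apply: ler_sum_fset => //; near: B; exact: near_totally.
by move: Ae XB; lra.
Unshelve. all: by end_near. Qed.

(** Write y = (y + n) - n, a difference of two nonnegative bounded families. *)
Lemma abs_cvg_partial_sum (y n : T -> R) M : (forall a, `|y a| <= n a) ->
  (forall A, \sum_(a <- A) n a <= M) -> exists l : R, partial_sum y @ totally --> l.
Proof.
move=> yn nM.
have n0 a : 0 <= n a by exact: le_trans (yn a).
have [l nl] := ge0_cvg_partial_sum n0 nM.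
have [|A|k kl] := @ge0_cvg_partial_sum (fun a => y a + n a) (M + M).
- by move=> a; have := yn a; rewrite ler_norml; lra.
- rewrite big_split lerD//=; apply: le_trans (nM A); apply: ler_sum => a _.
  exact: le_trans (ler_norm _) (yn a).
exists (k - l); apply: cvg_trans (cvgB kl nl); apply: near_eq_cvg.
by near=> A; rewrite !fctE !partial_sumE big_split/= addrK.
Unshelve. all: by end_near. Qed.

Lemma normc_le_ReIm (z : R[i]) : normc z <= `|complex.Re z| + `|complex.Im z|.
Proof.
case: z => a b /=; rewrite -[leRHS]ger0_norm ?addr_ge0// -sqrtr_sqr ler_wsqrtr//.
rewrite sqrrD !real_normK ?num_real// mulr2n.
by have := mulr_ge0 (normr_ge0 a) (normr_ge0 b); lra.
Qed.

Lemma normc_ge_abs (z : R[i]) : `|complex.Re z| <= normc z /\ `|complex.Im z| <= normc z.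
Proof.
case: z => a b /=; rewrite -!sqrtr_sqr; split; rewrite ler_wsqrtr//.
- by rewrite lerDl sqr_ge0.
- by rewrite lerDr sqr_ge0.
Qed.

Lemma complex_gt0 (e : R[i]) : 0 < e -> e = (complex.Re e)%:C%C /\ 0 < complex.Re e.
Proof. by case: e => a b; rewrite ltcE/= => /andP[/eqP -> ->]. Qed.

Lemma cvg_normcP (S : Type) (F : set_system S) {FF : Filter F}
    (u : S -> R[i]^o) (l : R[i]^o) :
  u @ F --> l <-> forall e : R, 0 < e -> \forall s \near F, normc (l - u s) < e.
Proof.
split=> [/cvgrPdist_lt ul e e0|ul].
  have /ul : 0 < e%:C%C by rewrite ltcR.
  by apply: filterS => s; rewrite normE ltcR.
apply/cvgrPdist_lt => e /complex_gt0[-> e0].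
by apply: filterS (ul _ e0) => s; rewrite normE ltcR.
Qed.

Lemma partial_sum_ReIm (x : T -> R[i]) A :
  complex.Re (partial_sum x A) = partial_sum (fun a => complex.Re (x a)) A /\
  complex.Im (partial_sum x A) = partial_sum (fun a => complex.Im (x a)) A.
Proof.
rewrite !partial_sumE; elim: (A : seq T) => [|a s [ihr ihi]]; first by rewrite !big_nil.
by rewrite !big_cons -ihr -ihi; case: (x a) (\sum_(_ <- _) _) => [? ?] [? ?].
Qed.

(** Splitting into real and imaginary parts reduces the claim to real families,
    so that completeness is only needed for the real numbers. *)
Lemma normc_cvg_partial_sum (x : T -> R[i]^o) M :
  (forall A, \sum_(a <- A) normc (x a) <= M) ->
  partial_sum x @ totally --> summability.sum x.
Proof.
move=> xM.
have [l xl] := abs_cvg_partial_sum (fun a => (normc_ge_abs (x a)).1) xM.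
have [k xk] := abs_cvg_partial_sum (fun a => (normc_ge_abs (x a)).2) xM.
have xc : partial_sum x @ totally --> ((l +i* k)%C : R[i]^o).
  apply/cvg_normcP => e e0.
  have e2 : 0 < e / 2 by lra.
  move/cvgrPdist_lt : xl => /(_ _ e2); move/cvgrPdist_lt : xk => /(_ _ e2).
  apply: filterS2 => A kA lA.
  apply: le_lt_trans (normc_le_ReIm _) _.
  have [rA iA] := partial_sum_ReIm x A.
  move: rA iA kA lA; case: (partial_sum x A) => [p q] /= -> ->; lra.
by rewrite /summability.sum; apply: cvgP xc.
Qed.

End unordered_sum.

(** * The pairing and convergence in the strong dual topology *)

Section pairing.
Variable R : realType.
Implicit Types (f : S1 R) (g h : Sm1 R) (r : word -> R).

Lemma Sm1_growth g : growth (Sm1_val g).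
Proof. by apply/Sm1P; case: g. Qed.

Lemma Sm1_valB g h : Sm1_val (g - h) = Sm1_val g - Sm1_val h.
Proof. by []. Qed.

Lemma dominated_partial_sum r f g (A : {fset word}) : rapid r -> dominated r f ->
  \sum_(a <- A) normc (S1_val f a * Sm1_val g a) <= fine (wnorm r (Sm1_val g)).
Proof.
move=> rr fr; have r0 : forall a, 0 <= r a by case: rr.
apply: (@le_trans _ _ (\sum_(a <- A) r a * normc (Sm1_val g a))).
  by apply: ler_sum => a _; rewrite normcM ler_wpM2r ?normc_ge0.
rewrite -lee_fin fineK; last by apply: wnorm_fin => //; exact: Sm1_growth.
by apply: fset_le_esum => a; rewrite mulr_ge0 ?normc_ge0.
Qed.

Lemma pairing_cvg f g :
  partial_sum (fun a => (S1_val f a * Sm1_val g a : R[i]^o)) @ totally --> pairing f g.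
Proof.
apply: normc_cvg_partial_sum => A.
by apply: dominated_partial_sum; first exact: (S1_rapid f).
Qed.

Lemma pairingB f g h : pairing f (g - h) = pairing f g - pairing f h.
Proof.
have gh : partial_sum (fun a => (S1_val f a * Sm1_val (g - h) a : R[i]^o)) @ totally -->
    (pairing f g - pairing f h : R[i]^o).
  apply: cvg_trans (cvgB (@pairing_cvg f g) (@pairing_cvg f h)).
  apply: near_eq_cvg; near=> A; rewrite !fctE !partial_sumE -sumrB.
  by apply: eq_bigr => a _; rewrite Sm1_valB -mulrBr.
exact: (norm_cvg_unique (@pairing_cvg f (g - h)) gh).
Unshelve. all: by end_near. Qed.

Lemma normc_pairing_le r f g : rapid r -> dominated r f ->
  normc (pairing f g) <= fine (wnorm r (Sm1_val g)).
Proof.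
move=> rr fr; apply/ler_addgt0Pr => e e0.
have /cvg_normcP/(_ _ e0)/filter_ex[A Ae] := @pairing_cvg f g.
have := le_normcD (pairing f g - partial_sum (fun a => S1_val f a * Sm1_val g a) A)
   (partial_sum (fun a => S1_val f a * Sm1_val g a) A).
rewrite subrK => /le_trans; apply; rewrite addrC lerD//; last exact: ltW.
rewrite partial_sumE; apply: le_trans (normc_sum _ _) _.
exact: dominated_partial_sum.
Qed.

(** The unimodular factor turning a nonzero [z] into its modulus; the value at 0
    only has to be at most 1 in modulus. *)
Definition phase (z : R[i]) : R[i] := if z == 0 then 0 else (normc z)%:C%C / z.

Lemma normc_real (x : R) : 0 <= x -> normc (x%:C%C) = x.
Proof. by move=> x0; rewrite /= expr0n/= addr0 sqrtr_sqr ger0_norm. Qed.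

Lemma phaseM z : phase z * z = (normc z)%:C%C.
Proof.
by rewrite /phase; case: eqVneq => [->|z0]; rewrite ?mulr0 ?normc0// divfK.
Qed.

Lemma normc_phase z : normc (phase z) <= 1.
Proof.
rewrite /phase; case: eqVneq => [_|z0]; first by rewrite normc0.
rewrite normcM normcV normc_real ?normc_ge0// divff//.
by apply: contra_neq z0 => /eq0_normc.
Qed.

(** The supremum of the pairing over a dominated set is attained at the family
    r(a) phase(g(a)), for which every term of the pairing is r(a) |g(a)|. *)
Lemma dominated_attained r g : rapid r ->
  exists2 f, dominated r f & (wnorm r (Sm1_val g) <= (normc (pairing f g))%:E)%E.
Proof.
move=> rr; have r0 : forall a, 0 <= r a by case: rr.
pose F : coefs R := fun a => (r a)%:C%C * phase (Sm1_val g a).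
have Fr a : normc (F a) <= r a.
  by rewrite normcM normc_real// ler_piMr// normc_phase.
have FS : F \in @in_S1 R.
  apply/S1P; split=> [a|p]; first exact: normc_ge0.
  have [C _ rC] := rapid_bound p rr; exists C => a.
  by apply: le_trans (rC a); rewrite ler_wpM2r// exprn_ge0.
exists (MkS1 FS) => //; apply: esum_le_fset => A; rewrite lee_fin.
apply/ler_addgt0Pr => e e0.
have /cvg_normcP/(_ _ e0) Ae := @pairing_cvg (MkS1 FS) g.
have [B [Be AB]] := filter_ex (filterI Ae (near_totally A)).
have FgE a : F a * Sm1_val g a = (r a * normc (Sm1_val g a))%:C%C.
  by rewrite -mulrA phaseM -rmorphM.
have PE : partial_sum (fun a => (F a * Sm1_val g a : R[i]^o)) B =
    (\sum_(a <- B) r a * normc (Sm1_val g a))%:C%C.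
  by rewrite partial_sumE rmorph_sum; apply: eq_bigr => a _.
have n0 a : 0 <= r a * normc (Sm1_val g a) by rewrite mulr_ge0// normc_ge0.
apply: (le_trans (ler_sum_fset n0 AB)).
rewrite -[leLHS]normc_real ?sumr_ge0// -PE.
set P := partial_sum _ _; have -> : P = pairing (MkS1 FS) g - (pairing (MkS1 FS) g - P).
  by rewrite opprB addrC subrK.
by apply: le_trans (le_normcD _ _) _; rewrite normcN lerD2l ltW.
Qed.

Lemma cvg_Sm1_unif (F : set_system (Sm1 R)) {FF : Filter F} g :
  F --> g <-> forall B : set (S1 R), vn_bounded B -> forall e : R, 0 < e ->
    \forall h \near F, forall f, B f -> normc (pairing f g - pairing f h) < e.
Proof.
pose ent e := [set xy : R[i]^o * R[i]^o | normc (xy.1 - xy.2) < e].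
have entE (E : set (R[i]^o * R[i]^o)) : entourage E ->
    exists2 e, 0 < e & ent e `<=` E.
  rewrite -entourage_ballE => -[e /= /complex_gt0[eE e0] eP].
  exists (complex.Re e) => // -[x y]/= xy; apply: eP; rewrite /= eE.
  by rewrite -ball_normE /ball_/= normE ltcR.
have ent_e e : 0 < e -> entourage (ent e).
  move=> e0; rewrite -entourage_ballE; exists e%:C%C; first by rewrite /= ltcR.
  by move=> -[x y]/=; rewrite -ball_normE /ball_/= normE ltcR.
split=> [Fg B Bb e e0|Fr].
  have := @initial_continuous _ _ (@functional R) g.
  have flt : Filter (@functional R @ nbhs g) by exact: fmap_filter.
  move/fam_cvgP => /(_ B Bb) gB.
  have : nbhs (functional g : {uniform` B -> R[i]^o})
     [set u | forall f, B f -> ent e (functional g f, u f)].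
    by apply/uniform_nbhs; exists (ent e); split => //; exact: ent_e.
  by move/gB/Fg; apply: filterS => h hB f Bf; exact: hB.
move=> U [_ [[V Vo <-] Vg VU]].
apply: filterS VU _.
have : (@functional R @ F) -->
    (functional g : {family @vn_bounded R[i] (S1 R), S1 R -> R[i]^o}).
  apply/fam_cvgP => B Bb W /uniform_nbhs[E [/entE[e e0 eE] EW]].
  rewrite nbhs_simpl; apply: filterS (Fr B Bb e e0) => h hB.
  by apply: EW => f Bf; apply: eE; exact: hB.
by apply; exact: open_nbhs_nbhs.
Qed.

(** Bounded sets are the subsets of dominated sets, and over a dominated set the
    supremum of the pairing is the weighted norm. *)
Lemma cvg_Sm1P (F : set_system (Sm1 R)) {FF : Filter F} g :
  F --> g <-> forall r, rapid r -> forall e : R, 0 < e ->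
    \forall h \near F, (wnorm r (Sm1_val (h - g)%R) < e%:E)%E.
Proof.
rewrite cvg_Sm1_unif; split=> [Fg r rr e e0|Fr B /bounded_dominated[r rr Br] e e0].
  apply: filterS (Fg _ (dominated_bounded rr) _ e0) => h hr.
  have [f fr /le_lt_trans] := dominated_attained (h - g) rr.
  by apply; rewrite lte_fin pairingB -normcN opprB; exact: hr.
apply: filterS (Fr r rr e e0) => h hr f /Br fr.
rewrite -normcN opprB -pairingB -lte_fin; apply: le_lt_trans hr.
rewrite -[leRHS]fineK ?lee_fin; first exact: normc_pairing_le.
by apply: wnorm_fin => //; exact: Sm1_growth.
Qed.

End pairing.

(** * The topological algebra *)

Section topological_algebra.
Variable R : realType.
Implicit Types (f g h : Sm1 R) (r s : word -> R) (c : R[i]).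

(** On Sm1 the weighted norm is finite, hence a genuine real seminorm. *)
Definition qnorm r h : R := fine (wnorm r (Sm1_val h)).

Lemma qnormK r h : rapid r -> (qnorm r h)%:E = wnorm r (Sm1_val h).
Proof. by move=> rr; rewrite fineK// wnorm_fin//; exact: Sm1_growth. Qed.

Lemma qnorm_ge0 r h : rapid r -> 0 <= qnorm r h.
Proof. by move=> [r0 _]; rewrite fine_ge0// wnorm_ge0. Qed.

Lemma qnormD r g h : rapid r -> qnorm r (g + h) <= qnorm r g + qnorm r h.
Proof. by move=> rr; rewrite -lee_fin EFinD !qnormK// wnormD//; case: rr. Qed.

Lemma qnormZ r c h : rapid r -> qnorm r (c *: h) = normc c * qnorm r h.
Proof.
by move=> rr; apply: EFin_inj; rewrite EFinM !qnormK// wnormZ//; case: rr.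
Qed.

Lemma cvg_qnormP (F : set_system (Sm1 R)) {FF : Filter F} g :
  F --> g <-> forall r, rapid r -> qnorm r (h - g) @[h --> F] --> (0 : R).
Proof.
rewrite cvg_Sm1P; split=> Fg r rr.
  apply/cvgr0Pnorm_lt => e e0; apply: filterS (Fg r rr e e0) => h.
  by rewrite ger0_norm ?qnorm_ge0// -qnormK.
move=> e e0; move/cvgr0Pnorm_lt : (Fg r rr) => /(_ e e0).
by apply: filterS => h; rewrite ger0_norm ?qnorm_ge0// -qnormK.
Qed.

(** The form in which continuity is checked below: one majorant tending to 0 for
    each weight. *)
Lemma cvg_qnorm_le (T : Type) (F : set_system T) {FF : Filter F} (u : T -> Sm1 R) g :
  (forall r, rapid r -> exists2 v : T -> R,
      v @ F --> (0 : R) & forall t, qnorm r (u t - g) <= v t) ->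
  u @ F --> g.
Proof.
move=> uv; apply/cvg_qnormP => r rr; have [v v0 uv'] := uv r rr.
apply: (@squeeze_cvgr _ _ _ _ (cst 0) v) => //; last exact: cvg_cst.
by near=> t; rewrite qnorm_ge0//= uv'.
Unshelve. all: by end_near. Qed.

Lemma wick_in_Sm1 f g : wick (Sm1_val f) (Sm1_val g) \in @in_Sm1 R.
Proof. by apply/Sm1P; apply: growth_wick; exact: Sm1_growth. Qed.

Definition wickS f g : Sm1 R := MkSm1 (wick_in_Sm1 f g).

Lemma wickS_Dl : left_distributive wickS +%R.
Proof. by move=> f g h; apply: val_inj; exact: wickDl. Qed.

Lemma wickS_Dr : right_distributive wickS +%R.
Proof. by move=> f g h; apply: val_inj; exact: wickDr. Qed.

Lemma qnorm_wick r s f g : rapid r -> rapid s ->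
  (forall a b, r (a ++ b) <= s a * s b) ->
  qnorm r (wickS f g) <= qnorm s f * qnorm s g.
Proof.
move=> rr ss rs; rewrite -lee_fin EFinM !qnormK//.
apply: wnorm_wick => //; [by case: rr|by case: ss|].
by apply: wnorm_fin => //; exact: Sm1_growth.
Qed.

Lemma cvg_qnorm_fst (T : topologicalType) r g (t : T) : rapid r ->
  qnorm r (x.1 - g) @[x --> (g, t)] --> (0 : R).
Proof.
move=> rr; have /cvg_qnormP/(_ r rr) : x.1 @[x --> (g, t)] --> g by exact: cvg_fst.
exact.
Qed.

Lemma cvg_qnorm_snd (T : topologicalType) r g (t : T) : rapid r ->
  qnorm r (x.2 - g) @[x --> (t, g)] --> (0 : R).
Proof.
move=> rr; have /cvg_qnormP/(_ r rr) : x.2 @[x --> (t, g)] --> g by exact: cvg_snd.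
exact.
Qed.

(** The majorant of x' y' - x y for a bilinear product, in terms of the distances
    u, v of the two factors from x, y of norms a, b. *)
Lemma cvg0_bilinear (T : Type) (F : set_system T) {FF : Filter F}
    (u v : T -> R) (a b : R) :
  u @ F --> (0 : R) -> v @ F --> (0 : R) ->
  u x * b + a * v x + u x * v x @[x --> F] --> (0 : R).
Proof.
move=> u0 v0.
have : u x * b + a * v x + u x * v x @[x --> F] --> (0 * b + a * 0 + 0 * 0 : R).
  by apply: cvgD; [apply: cvgD; [exact: cvgMr_tmp|exact: cvgMl_tmp]|exact: cvgM].
by rewrite mul0r !mulr0 !addr0.
Qed.

Lemma wickS_continuous : continuous (fun fg : Sm1 R * Sm1 R => wickS fg.1 fg.2).
Proof.
move=> [f g]; apply: cvg_qnorm_le => r rr; have [s ss rs] := rapid_split rr.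
exists (fun x => qnorm s (x.1 - f) * qnorm s g + qnorm s f * qnorm s (x.2 - g)
    + qnorm s (x.1 - f) * qnorm s (x.2 - g)).
  by apply: cvg0_bilinear; [exact: cvg_qnorm_fst|exact: cvg_qnorm_snd].
move=> [f' g'] /=.
have -> : wickS f' g' - wickS f g =
    wickS (f' - f) g + wickS f (g' - g) + wickS (f' - f) (g' - g).
  rewrite -{1}(subrK f f') -{1}(subrK g g').
  move: (f' - f) (g' - g) => x y; rewrite !wickS_Dl !wickS_Dr.
  by rewrite !addrA addrK -addrA addrC.
apply: le_trans (qnormD _ _ rr) (lerD _ (qnorm_wick _ _ rr ss rs)).
by apply: le_trans (qnormD _ _ rr) _; apply: lerD; exact: qnorm_wick.
Qed.

Lemma Sm1_add_continuous : continuous (fun fg : Sm1 R * Sm1 R => fg.1 + fg.2).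
Proof.
move=> [f g]; apply: cvg_qnorm_le => r rr.
exists (fun x => qnorm r (x.1 - f) + qnorm r (x.2 - g)).
  rewrite -[X in _ --> X]addr0.
  by apply: cvgD; [exact: cvg_qnorm_fst|exact: cvg_qnorm_snd].
by move=> [f' g'] /=; rewrite opprD addrACA qnormD.
Qed.

Lemma Sm1_scale_continuous : continuous (fun cx : R[i]^o * Sm1 R => cx.1 *: cx.2).
Proof.
move=> [c g]; apply: cvg_qnorm_le => r rr.
exists (fun x => normc (x.1 - c) * qnorm r g + normc c * qnorm r (x.2 - g)
    + normc (x.1 - c) * qnorm r (x.2 - g)).
  apply: cvg0_bilinear; last exact: cvg_qnorm_snd.
  apply/cvgr0Pnorm_lt => e e0.
  have /cvg_normcP/(_ e e0) : x.1 @[x --> (c, g)] --> c by exact: cvg_fst.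
  by apply: filterS => x; rewrite ger0_norm ?normc_ge0// -normcN opprB.
move=> [c' g'] /=.
have -> : c' *: g' - c *: g = (c' - c) *: g + c *: (g' - g) + (c' - c) *: (g' - g).
  rewrite -{1}(subrK c c') -{1}(subrK g g').
  move: (c' - c) (g' - g) => x y; rewrite !scalerDl !scalerDr.
  by rewrite !addrA addrK -addrA addrC.
rewrite -!qnormZ//.
by apply: le_trans (qnormD _ _ rr) _; rewrite lerD2r qnormD.
Qed.

Lemma wick_one_in_Sm1 : wick_one R \in @in_Sm1 R.
Proof.
apply/Sm1P; exists 0%N, 1 => a; rewrite expr0 mulr1 /wick_one.
by case: (a == [::]); rewrite ?normc1// normc0.
Qed.

Lemma wickS_topological_algebra : is_topological_algebra wickS.
Proof.
split.
- by move=> f g h; apply: val_inj; exact: wickA.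
- exact: wickS_Dl.
- exact: wickS_Dr.
- by move=> c f g; apply: val_inj; rewrite /= wickZl.
- by move=> c f g; apply: val_inj; rewrite /= wickZr.
- exists (MkSm1 wick_one_in_Sm1); split=> f; apply: val_inj;
    [exact: wick1l|exact: wick1r].
- exact: Sm1_add_continuous.
- exact: Sm1_scale_continuous.
- exact: wickS_continuous.
Qed.

End topological_algebra.

Theorem theorem4p3 (R : realType) :
  exists wickS : Sm1 R -> Sm1 R -> Sm1 R,
    (forall f g : Sm1 R, Sm1_val (wickS f g) = wick (Sm1_val f) (Sm1_val g)) /\
    continuous (fun fg : Sm1 R * Sm1 R => wickS fg.1 fg.2) /\
    is_topological_algebra wickS.
Proof.
exists (@wickS R); split=> //.
by split; [exact: wickS_continuous|exact: wickS_topological_algebra].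
Qed.
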